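(* Let $(A,\Gamma)$ be a connective, finite-type, flat graded Hopf algebroid. If $A$ is not the zero ring, then the category of connective graded $\Gamma$-comodules is not equivalent to the category of (ungraded) modules over any ring.
   Context: All gradings are $\mathbb{Z}$-gradings. A graded object is connective if it is trivial in all negative degrees. $\Sigma$ denotes suspension: $\Sigma A$ is $A$ with all grading degrees increased by one. A graded Hopf algebroid $(A,\Gamma)$ is a cogroupoid object in the category of graded-commutative rings. It is flat if $\Gamma$ is flat over $A$; connective if $A$ and $\Gamma$ are both connective; and finite-type if there is an exact sequence of graded $A$-modules $\coprod_{i\in\mathbb{Z}}\Sigma^i A^{\oplus b_i}\to\coprod_{i\in\mathbb{Z}}\Sigma^i A^{\oplus a_i}\to\Gamma\to 0$ with all $a_i,b_i$ finite nonnegative integers. (Because of the conjugation of $\Gamma$, it does not matter for flatness or finite-type whether the left or the right $A$-module structure is used.) A graded $\Gamma$-comodule is a graded $A$-module $M$ with a counital, coassociative, grading-preserving coaction $M\to\Gamma\otimes_A M$; it is connective if its underlying graded $A$-module is. Morphisms of connective graded comodules are the grading-preserving comodule maps. *)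

(* Defs.v *)
From HB Require Import structures.
From mathcomp Require Import all_boot all_order all_algebra.
From mathcomp Require Import generic_quotient zify.
From mathcomp Require Import boolp classical_sets functions cardinality fsbigop.

Set Implicit Arguments.
Unset Strict Implicit.
Unset Printing Implicit Defensive.

Import GRing.Theory.
Local Open Scope ring_scope.
Local Open Scope classical_set_scope.
Local Open Scope quotient_scope.

(* Right A-modules are encoded as left A^c-modules. A formal finite sum of
   pairs is a sequence; [tensor N M] is the quotient of these by the congruence
   generated by the usual relations, the opposite of a class being obtained by
   negating the left components. *)

Section Tensor.
Variables (A : pzRingType) (N : lmodType A^c) (M : lmodType A).

Inductive teq : seq (N * M) -> seq (N * M) -> Prop :=
| teq_refl s : teq s s
| teq_sym s t : teq s t -> teq t s
| teq_trans t s u : teq s t -> teq t u -> teq s u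
| teq_perm s t : perm_eq s t -> teq s t
| teq_cat s s' t t' : teq s s' -> teq t t' -> teq (s ++ t) (s' ++ t')
| teq_zero m : teq [:: (0, m)] [::]
| teq_addl x y m : teq [:: (x + y, m)] [:: (x, m); (y, m)]
| teq_addr x m n : teq [:: (x, m + n)] [:: (x, m); (x, n)]
| teq_bal (a : A) x m : teq [:: ((a : A^c) *: x, m)] [:: (x, a *: m)].

Definition teqb s t := `[< teq s t >].

Lemma teqb_refl : reflexive teqb.
Proof. by move=> s; apply/asboolP; exact: teq_refl. Qed.

Lemma teqb_sym : symmetric teqb.
Proof. by move=> s t; apply/asboolP/asboolP; exact: teq_sym. Qed.

Lemma teqb_trans : transitive teqb.
Proof.
move=> t s u /asboolP st /asboolP tu.
by apply/asboolP; exact: teq_trans st tu.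
Qed.

Definition teq_rel := EquivRel teqb teqb_refl teqb_sym teqb_trans.

Definition tensor : Type := {eq_quot teq_rel}.
HB.instance Definition _ := Choice.on tensor.

Definition tcls (s : seq (N * M)) : tensor := \pi_({eq_quot teq_rel}) s.
Definition trep (t : tensor) : seq (N * M) := repr (t : {eq_quot teq_rel}).

Lemma tclsP s t : tcls s = tcls t <-> teq s t.
Proof.
split=> [/eqmodP/asboolP //|st].
by apply/eqmodP/asboolP.
Qed.

Lemma trepK t : tcls (trep t) = t.
Proof. exact: reprK. Qed.

Lemma teq_trep s : teq (trep (tcls s)) s.
Proof. by apply/tclsP; rewrite trepK. Qed.

Definition tneg (s : seq (N * M)) := [seq (- p.1, p.2) | p <- s].

Lemma teq_negr s : teq (tneg s ++ s) [::].
Proof.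
elim: s => [|[x m] s IHs]; first exact: teq_refl.
have h : teq ([:: (- x, m); (x, m)] ++ (tneg s ++ s)) ([::] ++ [::]).
  apply: teq_cat => //.
  apply: teq_trans (teq_zero m); rewrite -(addNr x).
  exact: teq_sym (teq_addl _ _ _).
apply: teq_trans h; apply: teq_perm => /=.
by rewrite perm_cons -cat_rcons -cats1 -catA perm_catCA.
Qed.

Lemma teq_neg s t : teq s t -> teq (tneg s) (tneg t).
Proof.
move=> st.
have h1 : teq (tneg s) (tneg s ++ (tneg t ++ t)).
  rewrite -{1}[tneg s]cats0; apply: teq_cat; first exact: teq_refl.
  exact/teq_sym/teq_negr.
have h2 : teq (tneg s ++ (tneg t ++ t)) (tneg t ++ (tneg s ++ s)).
  rewrite catA; apply: teq_trans (_ : teq ((tneg t ++ tneg s) ++ s) _).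
    apply: teq_cat; last exact: teq_sym.
    by apply: teq_perm; rewrite perm_catC.
  by rewrite catA; exact: teq_refl.
apply: teq_trans h1 _; apply: teq_trans h2 _.
rewrite -[X in teq _ X]cats0; apply: teq_cat; first exact: teq_refl.
exact: teq_negr.
Qed.

Definition tadd t u := tcls (trep t ++ trep u).
Definition topp t := tcls (tneg (trep t)).

Lemma tclsD s t : tadd (tcls s) (tcls t) = tcls (s ++ t).
Proof. by apply/tclsP/teq_cat; exact: teq_trep. Qed.

Lemma taddA : associative tadd.
Proof.
move=> t u v; rewrite -(trepK t) -(trepK u) -(trepK v).
by rewrite !tclsD catA.
Qed.

Lemma taddC : commutative tadd.
Proof. by move=> t u; apply/tclsP/teq_perm; rewrite perm_catC. Qed.

Lemma tadd0 : left_id (tcls [::]) tadd.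
Proof. by move=> t; rewrite -(trepK t) tclsD. Qed.

Lemma taddN : left_inverse (tcls [::]) topp tadd.
Proof. by move=> t; rewrite -{2}(trepK t) tclsD; apply/tclsP/teq_negr. Qed.

HB.instance Definition _ :=
  GRing.isZmodule.Build tensor taddA taddC tadd0 taddN.

Definition tens (x : N) (m : M) : tensor := tcls [:: (x, m)].

Lemma tcls_sum s : tcls s = \sum_(p <- s) tens p.1 p.2.
Proof.
elim: s => [|[x m] s IHs]; first by rewrite big_nil.
by rewrite big_cons -IHs -cat1s; rewrite -tclsD.
Qed.

Lemma tensDl x y m : tens (x + y) m = tens x m + tens y m.
Proof. by rewrite [RHS]tclsD; apply/tclsP/teq_addl. Qed.

Lemma tensDr x m n : tens x (m + n) = tens x m + tens x n.
Proof. by rewrite [RHS]tclsD; apply/tclsP/teq_addr. Qed.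

Lemma tens_bal (a : A) x m : tens ((a : A^c) *: x) m = tens x (a *: m).
Proof. exact/tclsP/teq_bal. Qed.

Definition balanced (P : zmodType) (f : N -> M -> P) :=
  [/\ forall x y m, f (x + y) m = f x m + f y m,
      forall x m n, f x (m + n) = f x m + f x n &
      forall (a : A) x m, f ((a : A^c) *: x) m = f x (a *: m)].

Lemma tens_balanced : balanced tens.
Proof. by split; [exact: tensDl | exact: tensDr | exact: tens_bal]. Qed.

(* The additive map with x (x) m |-> f x m, see [tlift_tens]; it is meaningful
   only for balanced f. *)
Definition tlift (P : zmodType) (f : N -> M -> P) (t : tensor) : P :=
  \sum_(p <- trep t) f p.1 p.2.

Section Lift.
Variables (P : zmodType) (f : N -> M -> P).
Hypothesis fb : balanced f.

Lemma balanced_teq s t : teq s t ->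
  \sum_(p <- s) f p.1 p.2 = \sum_(p <- t) f p.1 p.2.
Proof.
case: fb => fDl fDr fbal.
elim=> {s t} [s//|s t _ ->//|t s u _ -> _ ->//|s t st|||||].
- exact: perm_big.
- by move=> s s' t t' _ e1 _ e2; rewrite !big_cat /= e1 e2.
- move=> m; rewrite big_seq1 big_nil /=.
  by apply: (addrI (f 0 m)); rewrite -fDl !addr0.
- by move=> x y m; rewrite !big_cons !big_nil /= !addr0 fDl.
- by move=> x m n; rewrite !big_cons !big_nil /= !addr0 fDr.
- by move=> a x m; rewrite !big_seq1 /= fbal.
Qed.

Lemma tlift_cls s : tlift f (tcls s) = \sum_(p <- s) f p.1 p.2.
Proof. exact/balanced_teq/teq_trep. Qed.

Lemma tlift_tens x m : tlift f (tens x m) = f x m.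
Proof. by rewrite tlift_cls big_seq1. Qed.

Lemma tliftD t u : tlift f (t + u) = tlift f t + tlift f u.
Proof. by rewrite [t + u]/(tadd t u) /tadd tlift_cls big_cat. Qed.

End Lift.

Lemma tensor_ind (Q : tensor -> Prop) :
  Q 0 -> (forall x m, Q (tens x m)) ->
  (forall t u, Q t -> Q u -> Q (t + u)) -> forall t, Q t.
Proof.
move=> Q0 Q1 QD t; rewrite -(trepK t) tcls_sum.
by elim/big_ind : _ => //= p _; exact: Q1.
Qed.

Lemma tens_ext (P : zmodType) (g h : tensor -> P) :
  {morph g : t u / t + u} -> {morph h : t u / t + u} ->
  (forall x m, g (tens x m) = h (tens x m)) -> g =1 h.
Proof.
move=> gD hD gh; apply: tensor_ind => //.
- by apply: (addrI (g 0)); rewrite -gD addr0; apply/esym;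
    apply: (addIr (h 0)); rewrite -addrA -hD addr0.
- by move=> t u gt gu; rewrite gD hD gt gu.
Qed.

End Tensor.

(* G as a left A-module (lres) or right A-module (rres) through e. *)
Definition lres (A G : pzRingType) (e : {rmorphism A -> G}) : Type := G.

Section LeftRestriction.
Variables (A G : pzRingType) (e : {rmorphism A -> G}).
HB.instance Definition _ := GRing.PzRing.copy (lres e) G.

Definition lres_scale (a : A) (x : lres e) : lres e := e a * (x : G).

Lemma lres_scaleA a b x : lres_scale a (lres_scale b x) = lres_scale (a * b) x.
Proof. by rewrite /lres_scale rmorphM mulrA. Qed.
Lemma lres_scale1 : left_id 1 lres_scale.
Proof. by move=> x; rewrite /lres_scale rmorph1 mul1r. Qed.
Lemma lres_scaleDr : right_distributive lres_scale +%R.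
Proof. by move=> a x y; rewrite /lres_scale mulrDr. Qed.
Lemma lres_scaleDl x : {morph lres_scale^~ x : a b / a + b}.
Proof. by move=> a b; rewrite /lres_scale rmorphD mulrDl. Qed.

HB.instance Definition _ := GRing.Zmodule_isLmodule.Build A (lres e)
  lres_scaleA lres_scale1 lres_scaleDr lres_scaleDl.
End LeftRestriction.

Definition rres (A G : pzRingType) (e : {rmorphism A -> G}) : Type := G.

Section RightRestriction.
Variables (A G : pzRingType) (e : {rmorphism A -> G}).
HB.instance Definition _ := GRing.PzRing.copy (rres e) G.

Definition rres_scale (a : A^c) (x : rres e) : rres e := (x : G) * e a.

Lemma rres_scaleA a b x : rres_scale a (rres_scale b x) = rres_scale (a * b) x.
Proof. by rewrite /rres_scale -mulrA -rmorphM. Qed.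
Lemma rres_scale1 : left_id 1 rres_scale.
Proof. by move=> x; rewrite /rres_scale rmorph1 mulr1. Qed.
Lemma rres_scaleDr : right_distributive rres_scale +%R.
Proof. by move=> a x y; rewrite /rres_scale mulrDl. Qed.
Lemma rres_scaleDl x : {morph rres_scale^~ x : a b / a + b}.
Proof. by move=> a b; rewrite /rres_scale rmorphD mulrDr. Qed.

HB.instance Definition _ := GRing.Zmodule_isLmodule.Build A^c (rres e)
  rres_scaleA rres_scale1 rres_scaleDr rres_scaleDl.
End RightRestriction.

(* G (x)_A M: the tensor product uses the right A-module structure on G given
   by eR, and the result is a left A-module through eL. *)
Definition gtensor (A G : pzRingType) (eL eR : {rmorphism A -> G})
  (M : lmodType A) : Type := tensor (rres eR) M.

Section GTensor.
Variables (A G : pzRingType) (eL eR : {rmorphism A -> G}).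

Section Lmod.
Variable M : lmodType A.
HB.instance Definition _ := GRing.Zmodule.on (gtensor eL eR M).

Definition gtens (x : G) (m : M) : gtensor eL eR M := tens (x : rres eR) m.

Definition glift (P : zmodType) (f : G -> M -> P) (t : gtensor eL eR M) : P :=
  tlift (f : rres eR -> M -> P) t.

Definition gbalanced (P : zmodType) (f : G -> M -> P) :=
  [/\ forall x y m, f (x + y) m = f x m + f y m,
      forall x m n, f x (m + n) = f x m + f x n &
      forall (a : A) x m, f (x * eR a) m = f x (a *: m)].

Lemma gtens_balanced : gbalanced gtens.
Proof. by have [h1 h2 h3] := tens_balanced (rres eR) M; split. Qed.

Lemma gbalanced_balanced (P : zmodType) (f : G -> M -> P) :
  gbalanced f -> balanced (f : rres eR -> M -> P).
Proof. by case=> h1 h2 h3; split. Qed.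

Lemma glift_tens (P : zmodType) (f : G -> M -> P) x m :
  gbalanced f -> glift f (gtens x m) = f x m.
Proof. by move=> /gbalanced_balanced fb; exact: (tlift_tens fb). Qed.

Lemma gliftD (P : zmodType) (f : G -> M -> P) :
  gbalanced f -> {morph glift f : t u / t + u}.
Proof. by move=> /gbalanced_balanced fb t u; exact: (tliftD fb). Qed.

Lemma gtens_ext (P : zmodType) (g h : gtensor eL eR M -> P) :
  {morph g : t u / t + u} -> {morph h : t u / t + u} ->
  (forall x m, g (gtens x m) = h (gtens x m)) -> g =1 h.
Proof. exact: tens_ext. Qed.

Lemma gtensor_ind (Q : gtensor eL eR M -> Prop) :
  Q 0 -> (forall x m, Q (gtens x m)) ->
  (forall t u, Q t -> Q u -> Q (t + u)) -> forall t, Q t.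
Proof. exact: (@tensor_ind A (rres eR) M Q). Qed.

Definition gscale (a : A) : gtensor eL eR M -> gtensor eL eR M :=
  glift (fun x m => gtens (eL a * x) m).

Lemma gscale_balanced a : gbalanced (fun x m => gtens (eL a * x) m).
Proof.
have [tDl tDr tb] := gtens_balanced.
by split=> *; rewrite ?mulrDr ?tDl ?tDr// mulrA tb.
Qed.

Lemma gscale_tens a x m : gscale a (gtens x m) = gtens (eL a * x) m.
Proof. exact: (glift_tens _ _ (gscale_balanced a)). Qed.

Lemma gscaleDr : right_distributive gscale +%R.
Proof. by move=> a t u; exact: (gliftD (gscale_balanced a)). Qed.

Lemma gscaleA a b t : gscale a (gscale b t) = gscale (a * b) t.
Proof.
move: t; apply: gtens_ext => [t u|t u|x m]; rewrite ?gscaleDr//.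
by rewrite !gscale_tens rmorphM mulrA.
Qed.

Lemma gscale1 : left_id 1 gscale.
Proof.
apply: gtens_ext => [t u|t u|x m] //; rewrite ?gscaleDr//.
by rewrite gscale_tens rmorph1 mul1r.
Qed.

Lemma gscaleDl t : {morph gscale^~ t : a b / a + b}.
Proof.
move=> a b; move: t; apply: gtens_ext => [t u|t u|x m].
- exact: gscaleDr.
- by rewrite !gscaleDr addrACA.
- have [tDl _ _] := gtens_balanced.
  by rewrite !gscale_tens rmorphD mulrDl tDl.
Qed.

HB.instance Definition _ := GRing.Zmodule_isLmodule.Build A (gtensor eL eR M)
  gscaleA gscale1 gscaleDr gscaleDl.

End Lmod.

Definition gmap (M M' : lmodType A) (f : M -> M')
  : gtensor eL eR M -> gtensor eL eR M' := glift (fun x m => gtens x (f m)).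

Section Gmap.
Variables (M M' : lmodType A) (f : {linear M -> M'}).

Lemma gmap_balanced : gbalanced (fun x m => gtens x (f m)).
Proof.
have [tDl tDr tb] := gtens_balanced M'.
by split=> *; rewrite ?linearD ?linearZ ?tDl ?tDr ?tb.
Qed.

Lemma gmap_tens x m : gmap f (gtens x m) = gtens x (f m).
Proof. exact: (glift_tens _ _ gmap_balanced). Qed.

Lemma gmapD : {morph gmap f : t u / t + u}.
Proof. by move=> t u; exact: (gliftD gmap_balanced). Qed.
End Gmap.

Lemma gmap_id M t : @gmap M M idfun t = t.
Proof.
move: t; apply: gtens_ext => [t u|t u|x m] //; first exact: gmapD.
by rewrite gmap_tens.
Qed.

Lemma gmap_comp (M1 M2 M3 : lmodType A)
  (g : {linear M2 -> M3}) (f : {linear M1 -> M2}) t :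
  gmap (g \o f) t = gmap g (gmap f t).
Proof.
move: t; apply: gtens_ext => [t u|t u|x m]; rewrite ?gmapD//.
by rewrite !gmap_tens.
Qed.

(* Flatness of G as a right A-module through eR: as G (x)_A - is right exact, it
   is exact as soon as it preserves injections. *)
Definition flat := forall (M M' : lmodType A) (f : {linear M -> M'}),
  injective f -> injective (@gmap M M' f).

End GTensor.

(* A grading of V is a direct sum decomposition V = (+)_(n : int) V_n, given
   by its projections; V_n is the image of [hcomp n], see [homog]. *)
Record grading (V : zmodType) := Grading {
  hcomp : int -> {additive V -> V};
  hcompK : forall i j x, hcomp i (hcomp j x) = if i == j then hcomp j x else 0;
  hcomp_fin : forall x, finite_set [set i | hcomp i x <> 0];
  hcomp_sum : forall x, x = \sum_(i \in [set: int]) hcomp i x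
}.

Definition homog V (g : grading V) (n : int) (x : V) : Prop := hcomp g n x = x.

Definition connective V (g : grading V) : Prop :=
  forall n x, (n < 0)%R -> homog g n x -> x = 0.

Definition degree_preserving U V (gU : grading U) (gV : grading V)
  (f : U -> V) : Prop := forall n x, homog gU n x -> homog gV n (f x).

Lemma homog_hcomp V (g : grading V) n x : homog g n (hcomp g n x).
Proof. by rewrite /homog hcompK eqxx. Qed.

Lemma hcomp_homog V (g : grading V) i n x :
  homog g n x -> hcomp g i x = if i == n then x else 0.
Proof. by move=> xn; rewrite -{1}xn hcompK xn. Qed.

Lemma homog_ind V (g : grading V) (Q : V -> Prop) :
  Q 0 -> (forall x y, Q x -> Q y -> Q (x + y)) ->
  (forall n x, homog g n x -> Q x) -> forall x, Q x.
Proof.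
move=> Q0 QD Qh x; rewrite [x](hcomp_sum g).
by elim/big_ind : _ => // i _; apply: Qh (homog_hcomp g i x).
Qed.

Section HomogeneousSums.
Variables (V P : zmodType) (g : grading V) (F : int -> V -> P).
Hypothesis FD : forall i, {morph F i : x y / x + y}.

Lemma hsumE (S : set int) x : finite_set S -> [set i | hcomp g i x <> 0] `<=` S ->
  \sum_(i \in [set: int]) F i (hcomp g i x) = \sum_(i \in S) F i (hcomp g i x).
Proof.
move=> Sfin xS; apply/esym/fsbig_widen => // i [_ iS] /=.
have [->|/eqP h] := eqVneq (hcomp g i x) 0; last by case: iS; exact: xS.
by apply: (addrI (F i 0)); rewrite -FD !addr0.
Qed.

Lemma hsum_supp x : \sum_(i \in [set: int]) F i (hcomp g i x)
  = \sum_(i \in [set i | hcomp g i x <> 0]) F i (hcomp g i x).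
Proof. by apply: hsumE => //; exact: hcomp_fin. Qed.

Lemma hsumD : {morph (fun x => \sum_(i \in [set: int]) F i (hcomp g i x)) :
  x y / x + y}.
Proof.
move=> x y /=.
set S := [set i | hcomp g i x <> 0] `|` [set i | hcomp g i y <> 0].
have Sfin : finite_set S by rewrite finite_setU; split; exact: hcomp_fin.
have xyS : [set i | hcomp g i (x + y) <> 0] `<=` S.
  move=> i /= xyi; apply: contrapT => /not_orP[/contrapT xi /contrapT yi].
  by apply: xyi; rewrite (raddfD (hcomp g i)) xi yi addr0.
have xS : [set i | hcomp g i x <> 0] `<=` S by move=> i; left.
have yS : [set i | hcomp g i y <> 0] `<=` S by move=> i; right.
rewrite (hsumE Sfin xyS) (hsumE Sfin xS) (hsumE Sfin yS).
rewrite -fsbig_split //=; apply: eq_fsbigr => i _.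
by rewrite (raddfD (hcomp g i)) FD.
Qed.

Lemma hsum_homog n x : homog g n x ->
  \sum_(i \in [set: int]) F i (hcomp g i x) = F n x.
Proof.
move=> xn; rewrite (@hsumE [set n]) ?fsbig_set1 ?xn//.
by move=> i /=; rewrite (hcomp_homog i xn); case: eqVneq.
Qed.

End HomogeneousSums.

Definition ksign (R : pzRingType) (i j : int) : R := (-1) ^+ (`|i| * `|j|)%N.

(* Graded-commutativity is the sign rule; x ^+ 2 = 0 for odd x is not imposed.
   The zero ring is allowed. *)
Record gcring := GCRing {
  gc_ring :> pzRingType;
  gc_grading : grading gc_ring;
  gc_one : homog gc_grading 0 1;
  gc_mul : forall i j x y, homog gc_grading i x -> homog gc_grading j y ->
    homog gc_grading (i + j) (x * y);
  gc_comm : forall i j x y, homog gc_grading i x -> homog gc_grading j y ->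
    x * y = ksign gc_ring i j * (y * x)
}.

Definition gr_scale_ax (A : gcring) (M : lmodType A) (g : grading M) : Prop :=
  forall i j (a : A) (m : M),
    homog (gc_grading A) i a -> homog g j m -> homog g (i + j) (a *: m).

(* The total degree on G (x)_A M. *)
Definition gtensor_homog (A : pzRingType) (G : gcring)
    (eL eR : {rmorphism A -> G}) (M : lmodType A) (gM : grading M)
    (n : int) (t : gtensor eL eR M) : Prop :=
  exists s : seq (G * M),
    t = \sum_(p <- s) gtens eL eR p.1 p.2 /\
    forall p, p \in s -> exists i j,
      [/\ i + j = n, homog (gc_grading G) i p.1 & homog gM j p.2].

Section KoszulProduct.
Variables (A G : gcring) (eL eR : {rmorphism A -> G}).
Local Notation GG := (gtensor eL eR (lres eL)).

(* The product of G (x)_A G as a graded-commutative ring (the pushout of eR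
   and eL): (x (x) y)(x' (x) y') = (-1)^(|y||x'|) xx' (x) yy' on homogeneous
   elements, see [gtensor_mulE]. *)
Definition koszul (x y x' y' : G) : GG :=
  \sum_(i \in [set: int]) \sum_(j \in [set: int])
    gtens eL eR (x * hcomp (gc_grading G) j x')
      (ksign G i j * (hcomp (gc_grading G) i y * y') : lres eL).

Definition gtensor_mul (t u : GG) : GG :=
  glift (fun (x : G) (y : lres eL) => glift (fun (x' : G) (y' : lres eL) =>
    koszul x y x' y') u) t.

Hypothesis eLdeg : degree_preserving (gc_grading A) (gc_grading G) eL.
Hypothesis eRdeg : degree_preserving (gc_grading A) (gc_grading G) eR.

Let tDl (x y : G) (m : lres eL) :
  gtens eL eR (x + y) m = gtens eL eR x m + gtens eL eR y m.
Proof. by have [h _ _] := gtens_balanced eL eR (lres eL); exact: h. Qed.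
Let tDr (x : G) (m n : G) :
  gtens eL eR x (m + n : lres eL)
  = gtens eL eR x (m : lres eL) + gtens eL eR x (n : lres eL).
Proof. by have [_ h _] := gtens_balanced eL eR (lres eL); exact: h. Qed.
Let t0 (x : G) : gtens eL eR x ((0 : G) : lres eL) = 0.
Proof.
have /esym := tDr x 0 0; rewrite addr0 => h.
by apply: (addrI (gtens eL eR x ((0 : G) : lres eL))); rewrite addr0.
Qed.
Let tb (a : A) (x y : G) :
  gtens eL eR (x * eR a) (y : lres eL) = gtens eL eR x (eL a * y : lres eL).
Proof. by have [_ _ h] := gtens_balanced eL eR (lres eL); exact: h. Qed.

Let inner_morph (x z y' : G) i j :
  {morph (fun x' => gtens eL eR (x * x') (ksign G i j * (z * y') : lres eL)) :
    x' y / x' + y}.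
Proof. by move=> x' y; rewrite mulrDr tDl. Qed.

Lemma koszulD2 x x' y' : {morph (fun y => koszul x y x' y') : y z / y + z}.
Proof.
apply: (@hsumD _ _ (gc_grading G) (fun i y => \sum_(j \in [set: int])
    gtens eL eR (x * hcomp (gc_grading G) j x')
      (ksign G i j * (y * y') : lres eL))) => i y z.
rewrite !(hsum_supp _ (@inner_morph x _ y' i)).
rewrite -fsbig_split; last exact: hcomp_fin.
by apply: eq_fsbigr => j _; rewrite mulrDl mulrDr tDr.
Qed.

Lemma koszulD3 x y y' : {morph (fun x' => koszul x y x' y') : u v / u + v}.
Proof.
move=> u v /=; rewrite /koszul.
have E w : \sum_(i \in [set: int]) \sum_(j \in [set: int])
    gtens eL eR (x * hcomp (gc_grading G) j w)
      (ksign G i j * (hcomp (gc_grading G) i y * y') : lres eL)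
  = \sum_(i \in [set i | hcomp (gc_grading G) i y <> 0])
    \sum_(j \in [set: int]) gtens eL eR (x * hcomp (gc_grading G) j w)
      (ksign G i j * (hcomp (gc_grading G) i y * y') : lres eL).
  apply/esym/fsbig_widen => // i [_ /= /contrapT ->]; apply: fsbig1 => j _.
  by rewrite mul0r mulr0 t0.
rewrite !E -fsbig_split; last exact: hcomp_fin.
by apply: eq_fsbigr => i _; exact: (hsumD _ (@inner_morph _ _ _ _)).
Qed.

Lemma koszulE x y x' y' i j :
  homog (gc_grading G) i y -> homog (gc_grading G) j x' ->
  koszul x y x' y' = gtens eL eR (x * x') (ksign G i j * (y * y') : lres eL).
Proof.
move=> yi xj; rewrite -(hsum_homog (@inner_morph x y y' i) xj).
apply: (hsum_homog (F := fun i y => \sum_(j \in [set: int])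
    gtens eL eR (x * hcomp (gc_grading G) j x')
      (ksign G i j * (y * y') : lres eL)) _ yi) => k u v.
rewrite !(hsum_supp _ (@inner_morph x _ y' k)).
rewrite -fsbig_split; last exact: hcomp_fin.
by apply: eq_fsbigr => l _; rewrite mulrDl mulrDr tDr.
Qed.

Lemma koszulD1 y x' y' : {morph (fun x => koszul x y x' y') : u v / u + v}.
Proof.
move=> u v; elim/(homog_ind (g := gc_grading G)): y => [|y z Hy Hz|i y yi].
- have E w : koszul w 0 x' y' = 0.
    by apply: (addrI (koszul w 0 x' y')); rewrite -koszulD2 !addr0.
  by rewrite /= !E addr0.
- by move: Hy Hz => /= Hy Hz; rewrite !koszulD2 Hy Hz addrACA.
elim/(homog_ind (g := gc_grading G)): x' => [|x z Hx Hz|j x xj].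
- have E w : koszul w y 0 y' = 0.
    by apply: (addrI (koszul w y 0 y')); rewrite -koszulD3 !addr0.
  by rewrite /= !E addr0.
- by move: Hx Hz => /= Hx Hz; rewrite !koszulD3 Hx Hz addrACA.
by rewrite /= !(koszulE _ _ yi xj) mulrDl tDl.
Qed.

Lemma koszulD4 x y x' : {morph (koszul x y x') : u v / u + v}.
Proof.
move=> u v; elim/(homog_ind (g := gc_grading G)): y => [|y z Hy Hz|i y yi].
- have E w : koszul x 0 x' w = 0.
    by apply: (addrI (koszul x 0 x' w)); rewrite -koszulD2 !addr0.
  by rewrite /= !E addr0.
- by move: Hy Hz => /= Hy Hz; rewrite !koszulD2 Hy Hz addrACA.
elim/(homog_ind (g := gc_grading G)): x' => [|x' z Hx Hz|j x' xj].
- have E w : koszul x y 0 w = 0.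
    by apply: (addrI (koszul x y 0 w)); rewrite -koszulD3 !addr0.
  by rewrite /= !E addr0.
- by move: Hx Hz => /= Hx Hz; rewrite !koszulD3 Hx Hz addrACA.
by rewrite /= !(koszulE _ _ yi xj) mulrDr mulrDr tDr.
Qed.

Let ksignD i j k : ksign G i (j + k) = ksign G i j * ksign G i k.
Proof.
rewrite /ksign -exprD -signr_odd -[RHS]signr_odd; congr (_ ^+ _).
rewrite oddD !oddM; case: (odd `|i|) => //=.
by congr nat_of_bool; lia.
Qed.

Let ksignC i j : ksign G i j = ksign G j i.
Proof. by rewrite /ksign mulnC. Qed.

Let ksign_comm i j (x : G) : x * ksign G i j = ksign G i j * x.
Proof. by apply/commr_sign. Qed.

Let eq_homog (P : zmodType) (f h : G -> P) :
  {morph f : x y / x + y} -> {morph h : x y / x + y} ->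
  (forall n x, homog (gc_grading G) n x -> f x = h x) -> f =1 h.
Proof.
move=> fD hD fh; apply: (homog_ind (g := gc_grading G)) => //.
- have f0 : f 0 = 0 by apply: (addrI (f 0)); rewrite -fD !addr0.
  have h0 : h 0 = 0 by apply: (addrI (h 0)); rewrite -hD !addr0.
  by rewrite f0 h0.
- by move=> x y ex ey; rewrite fD hD ex ey.
Qed.

Let eq_homogA (P : zmodType) (f h : A -> P) :
  {morph f : x y / x + y} -> {morph h : x y / x + y} ->
  (forall n x, homog (gc_grading A) n x -> f x = h x) -> f =1 h.
Proof.
move=> fD hD fh; apply: (homog_ind (g := gc_grading A)) => //.
- have f0 : f 0 = 0 by apply: (addrI (f 0)); rewrite -fD !addr0.
  have h0 : h 0 = 0 by apply: (addrI (h 0)); rewrite -hD !addr0.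
  by rewrite f0 h0.
- by move=> x y ex ey; rewrite fD hD ex ey.
Qed.

Let tsign i j (x y : G) : gtens eL eR (ksign G i j * x) (y : lres eL)
  = gtens eL eR x (ksign G i j * y : lres eL).
Proof.
rewrite /ksign -signr_odd; case: odd; rewrite ?expr0 ?expr1 ?mul1r// !mulN1r.
apply: (addrI (gtens eL eR x (y : lres eL))).
have t0l m : gtens eL eR 0 (m : lres eL) = 0.
  apply: (addrI (gtens eL eR 0 (m : lres eL))).
  by rewrite -tDl !addr0.
by rewrite -tDl -[RHS]tDr !subrr t0 t0l.
Qed.

Lemma koszul_bal2 x y x' y' a :
  koszul x y (x' * eR a) y' = koszul x y x' (eL a * y').
Proof.
apply: (@eq_homog _ (fun y => koszul x y (x' * eR a) y')
  (fun y => koszul x y x' (eL a * y'))) => [||i {}y yi];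
  [exact: koszulD2|exact: koszulD2|].
apply: (@eq_homog _ (fun x' => koszul x y (x' * eR a) y')
  (fun x' => koszul x y x' (eL a * y'))) => [u v||j {}x' xj].
- by rewrite /= mulrDl koszulD3.
- exact: koszulD3.
apply: (@eq_homogA _ (fun a => koszul x y (x' * eR a) y')
  (fun a => koszul x y x' (eL a * y'))) => [u v|u v|k {}a ak].
- by rewrite /= rmorphD mulrDr koszulD3.
- by rewrite /= rmorphD mulrDl koszulD4.
rewrite (koszulE _ _ yi (gc_mul xj (eRdeg ak))) (koszulE _ _ yi xj) mulrA tb.
congr (gtens _ _ _ _).
rewrite (mulrA y) (gc_comm yi (eLdeg ak)) ksignD !mulrA.
by rewrite (ksign_comm i j) -[_ * eL a * _]mulrA (ksign_comm i k) !mulrA.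
Qed.

Lemma koszul_bal1 x y x' y' a :
  koszul (x * eR a) y x' y' = koszul x (eL a * y) x' y'.
Proof.
apply: (@eq_homog _ (fun y => koszul (x * eR a) y x' y')
  (fun y => koszul x (eL a * y) x' y')) => [|u v|i {}y yi].
- exact: koszulD2.
- by rewrite /= mulrDr koszulD2.
apply: (@eq_homog _ (fun x' => koszul (x * eR a) y x' y')
  (fun x' => koszul x (eL a * y) x' y')) => [||j {}x' xj];
  [exact: koszulD3|exact: koszulD3|].
apply: (@eq_homogA _ (fun a => koszul (x * eR a) y x' y')
  (fun a => koszul x (eL a * y) x' y')) => [u v|u v|k {}a ak].
- by rewrite /= rmorphD mulrDr koszulD1.
- by rewrite /= rmorphD mulrDl koszulD2.
rewrite (koszulE _ _ yi xj) (koszulE _ _ (gc_mul (eLdeg ak) yi) xj).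
rewrite -mulrA (gc_comm (eRdeg ak) xj) mulrA (ksign_comm k j) -mulrA tsign.
rewrite mulrA tb; congr (gtens _ _ _ _).
rewrite (ksignC (k + i)) ksignD (ksignC j k) (ksignC j i) !mulrA.
by rewrite (ksign_comm k j) -[_ * eL a * _]mulrA (ksign_comm i j) !mulrA.
Qed.

Lemma koszul_balanced x y :
  gbalanced eR (fun (x' : G) (y' : lres eL) => koszul x y x' y').
Proof.
split=> [u v m|u m n|a x' y']; [exact: koszulD3|exact: koszulD4|].
exact: koszul_bal2.
Qed.

Lemma gtensor_mul_balanced (u : GG) : gbalanced eR (fun (x : G) (y : lres eL) =>
  glift (fun (x' : G) (y' : lres eL) => koszul x y x' y') u).
Proof.
pose L (x y : G) : GG -> GG :=
  glift (fun (x' : G) (y' : lres eL) => koszul x y x' y').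
have LD x y : {morph L x y : u v / u + v} by exact: gliftD (koszul_balanced x y).
have LE x y x' (y' : lres eL) : L x y (gtens eL eR x' y') = koszul x y x' y'.
  exact: (glift_tens eL x' y' (koszul_balanced x y)).
rewrite -[X in gbalanced _ X]/(fun (x : G) (y : lres eL) => L x y u).
split=> [x y m|x m n|a x m].
- apply: (@gtens_ext _ _ _ _ _ _ (L (x + y) m) (fun u => L x m u + L y m u))
    => [||x' y']; [exact: LD|by move=> v w /=; rewrite !LD addrACA|].
  by rewrite !LE; exact: koszulD1.
- apply: (@gtens_ext _ _ _ _ _ _ (L x (m + n)) (fun u => L x m u + L x n u))
    => [||x' y']; [exact: LD|by move=> v w /=; rewrite !LD addrACA|].
  by rewrite !LE; exact: koszulD2.
- apply: (@gtens_ext _ _ _ _ _ _ (L (x * eR a) m) (L x (eL a * (m : G))))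
    => [||x' y']; [exact: LD|exact: LD|].
  by rewrite !LE; exact: koszul_bal1.
Qed.

Lemma gtensor_mulE i j (x y x' y' : G) :
  homog (gc_grading G) i y -> homog (gc_grading G) j x' ->
  gtensor_mul (gtens eL eR x (y : lres eL)) (gtens eL eR x' (y' : lres eL))
  = gtens eL eR (x * x') (ksign G i j * (y * y') : lres eL).
Proof.
move=> yi xj; rewrite /gtensor_mul.
have -> := glift_tens eL x (y : lres eL) (gtensor_mul_balanced (gtens eL eR x' (y' : lres eL))).
have -> := glift_tens eL x' (y' : lres eL) (koszul_balanced x y).
exact: koszulE.
Qed.

End KoszulProduct.

(* hA corepresents the objects and hG the morphisms. All tensor products are
   over hA, with hG a right module through etaR on the left of the tensor sign
   and a left module through etaL on its right. *)
Record hopf_algebroid := HopfAlgebroid {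
  hA : gcring;
  hG : gcring;
  etaL : {rmorphism hA -> hG};
  etaR : {rmorphism hA -> hG};
  counit : {rmorphism hG -> hA};
  conj : {rmorphism hG -> hG};
  comul : hG -> gtensor etaL etaR (lres etaL);
  etaL_deg : degree_preserving (gc_grading hA) (gc_grading hG) etaL;
  etaR_deg : degree_preserving (gc_grading hA) (gc_grading hG) etaR;
  counit_deg : degree_preserving (gc_grading hG) (gc_grading hA) counit;
  conj_deg : degree_preserving (gc_grading hG) (gc_grading hG) conj;
  comul_deg : forall n x, homog (gc_grading hG) n x ->
    gtensor_homog (gc_grading hG : grading (lres etaL)) n (comul x);
  comulD : {morph comul : x y / x + y};
  comul1 : comul 1 = gtens etaL etaR 1 (1 : lres etaL);
  comulM : forall x y, comul (x * y) = gtensor_mul (comul x) (comul y);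
  counit_etaL : forall a, counit (etaL a) = a;
  counit_etaR : forall a, counit (etaR a) = a;
  comul_etaL : forall a, comul (etaL a) = gtens etaL etaR (etaL a) (1 : lres etaL);
  comul_etaR : forall a, comul (etaR a) = gtens etaL etaR 1 (etaR a : lres etaL);
  counit_comul_l : forall x,
    glift (fun (y : hG) (z : lres etaL) => etaL (counit y) * (z : hG)) (comul x)
    = x;
  counit_comul_r : forall x,
    glift (fun (y : hG) (z : lres etaL) => y * etaR (counit (z : hG))) (comul x)
    = x;
  (* (comul (x) 1) comul = (1 (x) comul) comul in G (x) (G (x) G) *)
  comulA : forall x,
    glift (fun (y : hG) (z : lres etaL) =>
      glift (fun (y1 : hG) (y2 : lres etaL) =>
        gtens etaL etaR y1 (gtens etaL etaR (y2 : hG) z)) (comul y)) (comul x)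
    = glift (fun (y : hG) (z : lres etaL) => gtens etaL etaR y (comul (z : hG)))
        (comul x);
  conj_etaL : forall a, conj (etaL a) = etaR a;
  conj_etaR : forall a, conj (etaR a) = etaL a;
  conjK : forall x, conj (conj x) = x;
  conj_comul_l : forall x,
    glift (fun (y : hG) (z : lres etaL) => conj y * (z : hG)) (comul x)
    = etaR (counit x);
  conj_comul_r : forall x,
    glift (fun (y : hG) (z : lres etaL) => y * conj (z : hG)) (comul x)
    = etaL (counit x)
}.

Definition hopf_connective (H : hopf_algebroid) : Prop :=
  connective (gc_grading (hA H)) /\ connective (gc_grading (hG H)).

Definition hopf_flat (H : hopf_algebroid) : Prop := flat (etaL H) (etaR H).

Section FreeModule.
Variables (A : gcring) (a : int -> nat).

Definition free_index : Type := {i : int & 'I_(a i)}.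
HB.instance Definition _ := Choice.on free_index.

Definition finsupp : {pred free_index -> A^o} :=
  [pred f : free_index -> A^o | `[< finite_set [set k | f k <> 0] >]].

(* The underlying left A-module of (+)_i Sigma^i A^(a i), graded by
   [free_homog]: the basis element indexed by (i, k) has degree i. *)
Record free_module := FreeModule {
  free_val :> free_index -> A^o;
  free_finsupp : free_val \in finsupp }.

HB.instance Definition _ := [isSub for free_val].
HB.instance Definition _ := [Choice of free_module by <:].

Lemma finsuppP f : f \in finsupp <-> finite_set [set k | f k <> 0].
Proof. by split=> [/asboolP|?] //; apply/asboolP. Qed.

Lemma finsupp_closed : subsemimod_closed finsupp.
Proof.
split; first split.
- apply/finsuppP.
  have -> : [set k : free_index | (0 : free_index -> A^o) k <> 0] = set0.
    by apply/seteqP; split=> k //= /(_ erefl).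
  exact: finite_set0.
- move=> f g /finsuppP ff /finsuppP fg; apply/finsuppP.
  apply: (@sub_finite_set _ _ ([set k | f k <> 0] `|` [set k | g k <> 0])).
    move=> k /= fgk; apply: contrapT => /not_orP[/contrapT fk /contrapT gk].
    by apply: fgk; rewrite addrfctE fk gk addr0.
  by rewrite finite_setU.
- move=> c f /finsuppP ff; apply/finsuppP.
  apply: sub_finite_set ff => k /= cfk fk; apply: cfk.
  by rewrite scalrfctE fk scaler0.
Qed.

HB.instance Definition _ :=
  GRing.SubChoice_isSubLmodule.Build A (free_index -> A^o) finsupp free_module
    finsupp_closed.

Definition free_homog (n : int) (f : free_module) : Prop :=
  forall k : free_index, homog (gc_grading A) (n - tag k) (f k).

End FreeModule.

(* Exactness of (+)_i Sigma^i A^(b i) -> (+)_i Sigma^i A^(a i) -> Gamma -> 0,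
   with the left A-module structure on Gamma. *)
Definition hopf_finite_type (H : hopf_algebroid) : Prop :=
  exists (a b : int -> nat)
    (d : {linear free_module (hA H) b -> free_module (hA H) a})
    (p : {linear free_module (hA H) a -> lres (etaL H)}),
    [/\ forall n f, free_homog n f -> free_homog n (d f),
        forall n f, free_homog n f -> homog (gc_grading (hG H)) n (p f),
        forall f, p f = 0 <-> exists g, d g = f &
        forall x, exists f, p f = x].

Record category := Category {
  ob :> Type;
  hom : ob -> ob -> Type;
  idm : forall X, hom X X;
  cmp : forall X Y Z, hom Y Z -> hom X Y -> hom X Z;
  cmp1m : forall X Y (f : hom X Y), cmp (idm Y) f = f;
  cmpm1 : forall X Y (f : hom X Y), cmp f (idm X) = f;
  cmpA : forall X Y Z W (f : hom Z W) (g : hom Y Z) (h : hom X Y),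
    cmp f (cmp g h) = cmp (cmp f g) h
}.

Record functor (C D : category) := Functor {
  fob :> C -> D;
  fmap : forall X Y, hom X Y -> hom (fob X) (fob Y);
  fmap1 : forall X, fmap (idm X) = idm (fob X);
  fmapM : forall X Y Z (f : hom Y Z) (g : hom X Y),
    fmap (cmp f g) = cmp (fmap f) (fmap g)
}.

Definition idF (C : category) : functor C C :=
  @Functor C C id (fun X Y f => f) (fun=> erefl) (fun _ _ _ _ _ => erefl).

Section FunctorComposition.
Variables (C D E : category) (G : functor D E) (F : functor C D).

Lemma compF1 (X : C) : fmap G (fmap F (idm X)) = idm (G (F X)).
Proof. by rewrite !fmap1. Qed.

Lemma compFM (X Y Z : C) (f : hom Y Z) (g : hom X Y) :
  fmap G (fmap F (cmp f g)) = cmp (fmap G (fmap F f)) (fmap G (fmap F g)).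
Proof. by rewrite !fmapM. Qed.

Definition compF : functor C E := Functor compF1 compFM.
End FunctorComposition.

Definition is_iso (C : category) (X Y : C) (f : hom X Y) : Prop :=
  exists g : hom Y X, cmp g f = idm X /\ cmp f g = idm Y.

Definition naturally_isomorphic (C D : category) (F G : functor C D) : Prop :=
  exists eta : forall X, hom (F X) (G X),
    (forall X Y (f : hom X Y), cmp (eta Y) (fmap F f) = cmp (fmap G f) (eta X))
    /\ forall X, is_iso (eta X).

Definition equivalent (C D : category) : Prop :=
  exists (F : functor C D) (G : functor D C),
    naturally_isomorphic (compF G F) (idF C) /\
    naturally_isomorphic (compF F G) (idF D).

Lemma linear_ext (R : pzRingType) (U V : lmodType R) (f g : {linear U -> V}) :
  f =1 g -> f = g.
Proof.
case: f g => [f [[fA] [fZ]]] [g [[gA] [gZ]]] /= /funext efg.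
by subst g; rewrite (Prop_irrelevance fA gA) (Prop_irrelevance fZ gZ).
Qed.

(* Left modules; right R-modules are [modules R^c]. *)
Definition modules (R : pzRingType) : category.
refine (@Category (lmodType R) (fun U V => {linear U -> V})
  (fun U => idfun) (fun U V W g f => g \o f) _ _ _).
Proof. all: by move=> *; exact: linear_ext. Defined.

Record comodule (H : hopf_algebroid) := Comodule {
  cm_mod :> lmodType (hA H);
  cm_grading : grading cm_mod;
  cm_scale : gr_scale_ax cm_grading;
  coact : {linear cm_mod -> gtensor (etaL H) (etaR H) cm_mod};
  coact_deg : forall n m, homog cm_grading n m ->
    gtensor_homog cm_grading n (coact m);
  coact_counit : forall m, glift (fun x n => counit H x *: n) (coact m) = m;
  (* (comul (x) 1) coact = (1 (x) coact) coact in G (x) (G (x) M) *)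
  coactA : forall m,
    glift (fun (x : hG H) (n : cm_mod) =>
      glift (fun (x1 : hG H) (x2 : lres (etaL H)) =>
        gtens (etaL H) (etaR H) x1 (gtens (etaL H) (etaR H) (x2 : hG H) n))
        (comul x)) (coact m)
    = gmap coact (coact m)
}.

Record comodule_hom (H : hopf_algebroid) (M N : comodule H) := ComoduleHom {
  ch_map :> {linear M -> N};
  ch_deg : degree_preserving (cm_grading M) (cm_grading N) ch_map;
  ch_coact : forall m, coact N (ch_map m) = gmap ch_map (coact M m)
}.

Lemma comodule_hom_ext H (M N : comodule H) (f g : comodule_hom M N) :
  f =1 g -> f = g.
Proof.
case: f g => [f fd fc] [g gd gc] /= /linear_ext efg; subst g.
by rewrite (Prop_irrelevance fd gd) (Prop_irrelevance fc gc).
Qed.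

Section ComoduleCategory.
Variable H : hopf_algebroid.

Lemma comodule_idm_coact (M : comodule H) m :
  coact M (idfun m) = gmap idfun (coact M m).
Proof. by rewrite gmap_id. Qed.

Definition comodule_idm (M : comodule H) : comodule_hom M M :=
  @ComoduleHom H M M idfun (fun _ _ => id) (@comodule_idm_coact M).

Variables (M N P : comodule H) (g : comodule_hom N P) (f : comodule_hom M N).

Lemma comodule_cmp_deg :
  degree_preserving (cm_grading M) (cm_grading P) (g \o f).
Proof. by move=> n m hm; do 2!apply: ch_deg. Qed.

Lemma comodule_cmp_coact m : coact P ((g \o f) m) = gmap (g \o f) (coact M m).
Proof. by rewrite gmap_comp -!ch_coact. Qed.

Definition comodule_cmp : comodule_hom M P :=
  @ComoduleHom H M P (g \o f) comodule_cmp_deg comodule_cmp_coact.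
End ComoduleCategory.

Record conn_comodule (H : hopf_algebroid) := ConnComodule {
  cc_comod :> comodule H;
  cc_conn : connective (cm_grading cc_comod)
}.

Definition connective_comodules (H : hopf_algebroid) : category.
refine (@Category (conn_comodule H) (fun M N => comodule_hom M N)
  (fun M => comodule_idm M) (fun M N P g f => comodule_cmp g f) _ _ _).
Proof. all: by move=> *; exact: comodule_hom_ext. Defined.

(* Main.v *)
Require Import Defs.
From HB Require Import structures.
From mathcomp Require Import all_boot all_order all_algebra.
From mathcomp Require Import generic_quotient zify.
From mathcomp Require Import boolp classical_sets functions cardinality fsbigop.
(* Imported again because [all_algebra] shadows [hom]. *)
Require Import Defs.
Set Implicit Arguments.
Unset Strict Implicit.
Unset Printing Implicit Defensive.
Import Order.TTheory GRing.Theory Num.Theory.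
Local Open Scope ring_scope.
Local Open Scope classical_set_scope.
Local Open Scope quotient_scope.

(* Let F be an equivalence onto R-modules, P a comodule with F P = R, and e in
   F P the element corresponding to 1, so that (P, e) represents F. For n >= 0
   let N_n be the A-submodule of P generated by the elements of degree at most
   n. As Gamma is connective and flat, N_n is a subcomodule, and P is the union
   of the chain of the N_n. Equivalences preserve jointly epic families, so e
   comes from some F N_n because F P is finitely generated; by
   representability the inclusion of this N_n then has a section, that is
   N_n = P. A morphism from P to Sigma^(n+1) A, which vanishes in degrees at
   most n, is thus zero, although P is a generator and A is nonzero. *)

(** * Equivalences with module categories *)

Lemma is_iso_epi (C : category) (X Y Z : C) (f : hom X Y) (g h : hom Y Z) :
  is_iso f -> cmp g f = cmp h f -> g = h.
Proof.
move=> [f' [_ ff']] gh.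
by rewrite -(cmpm1 g) -(cmpm1 h) -ff' !cmpA gh.
Qed.

Lemma is_iso_mono (C : category) (X Y Z : C) (f : hom Y Z) (g h : hom X Y) :
  is_iso f -> cmp f g = cmp f h -> g = h.
Proof.
move=> [f' [f'f _]] gh.
by rewrite -(cmp1m g) -(cmp1m h) -f'f -!cmpA gh.
Qed.

Definition faithful (C D : category) (F : functor C D) :=
  forall (X Y : C) (f g : hom X Y), fmap F f = fmap F g -> f = g.

Definition full (C D : category) (F : functor C D) :=
  forall (X Y : C) (f : hom (F X) (F Y)), exists g : hom X Y, fmap F g = f.

Definition essentially_surjective (C D : category) (F : functor C D) :=
  forall Y : D, exists (X : C) (f : hom (F X) Y), is_iso f.

Lemma left_invertible_faithful (C D : category) (F : functor C D)
  (G : functor D C) : naturally_isomorphic (compF G F) (idF C) -> faithful F.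
Proof.
move=> [eps [nat iso]] X Y f g Ffg.
apply: (is_iso_epi (iso X)); move: (nat _ _ f) (nat _ _ g) => /= <- <-.
by rewrite Ffg.
Qed.

Lemma equivalence_properties (C D : category) : equivalent C D ->
  exists F : functor C D, [/\ faithful F, full F & essentially_surjective F].
Proof.
move=> [F [G [GF FG]]]; exists F.
have fF := left_invertible_faithful GF; have fG := left_invertible_faithful FG.
split=> // [X Y f|Y].
  have [eps [nat iso]] := GF; have [e' [e'e ee']] := iso X.
  (* The preimage of [f] is [fmap G f] conjugated by [eps]. As [G] is faithful, it suffices to
     compare after [G], and there naturality of [eps] applies. *)
  exists (cmp (eps Y) (cmp (fmap G f) e')); apply: fG.
  apply: (is_iso_mono (iso Y)); rewrite (nat _ _ (cmp _ _)) /=.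
  by rewrite -!cmpA e'e cmpm1.
by have [del [_ iso]] := FG; exists (G Y), (del Y); exact: iso.
Qed.

(** * Submodules and quotient modules *)

Record submodule (R : pzRingType) (V : lmodType R) := Submodule {
  sub_pred :> {pred V};
  sub_closed : submod_closed sub_pred
}.

Section Submodule.
Variables (R : pzRingType) (V : lmodType R) (N : submodule V).

HB.instance Definition _ :=
  GRing.isSubmodClosed.Build R V (sub_pred N) (sub_closed N).

Record submod : Type := Submod { submod_val : V; submodP : submod_val \in N }.
HB.instance Definition _ := [isSub for submod_val].
HB.instance Definition _ := [Choice of submod by <:].
HB.instance Definition _ :=
  GRing.SubChoice_isSubLmodule.Build R V (sub_pred N) submod
    (GRing.submod_closed_semi (sub_closed N)).

End Submodule.

Section QuotientModule.
Variables (R : pzRingType) (V : lmodType R) (N : submodule V).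

(** [N] bundles a predicate with its closure, so that the quotient by a submodule built inside a
    proof is a module at once. The additive quotient receives its scalar action through
    representatives. *)
Definition quotmod : Type := {ideal_quot (sub_pred N)}.
HB.instance Definition _ := GRing.Zmodule.on quotmod.

Definition quotpi (x : V) : quotmod :=
  \pi_({ideal_quot (sub_pred N)}) (x : GRing.Zmodule.sort V).

Lemma quotpi_surj (x : quotmod) : exists y, x = quotpi y.
Proof.
by exists (repr (x : {ideal_quot (sub_pred N)})); rewrite /quotpi reprK.
Qed.

Lemma quotpi_eq x y : quotpi x = quotpi y <-> x - y \in sub_pred N.
Proof. by rewrite Quotient.idealrBE; split => [|/eqP] => [/eqP|]. Qed.

Definition quotscale (a : R) (x : quotmod) : quotmod :=
  quotpi (a *: (repr (x : {ideal_quot (sub_pred N)}) : V)).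

Lemma quotscale_pi a x : quotscale a (quotpi x) = quotpi (a *: x).
Proof.
apply/quotpi_eq; rewrite -scalerBr rpredZ//.
by apply/quotpi_eq; rewrite /quotpi reprK.
Qed.

Lemma quotpiD : {morph quotpi : x y / x + y}.
Proof. by move=> x y; rewrite /quotpi raddfD. Qed.

Lemma quotscaleA a b x : quotscale a (quotscale b x) = quotscale (a * b) x.
Proof. by have [{}x ->] := quotpi_surj x; rewrite !quotscale_pi scalerA. Qed.

Lemma quotscale1 : left_id 1 quotscale.
Proof.
by move=> x; have [{}x ->] := quotpi_surj x; rewrite quotscale_pi scale1r.
Qed.

Lemma quotscaleDr : right_distributive quotscale +%R.
Proof.
move=> a x y; have [{}x ->] := quotpi_surj x; have [{}y ->] := quotpi_surj y.
by rewrite -quotpiD !quotscale_pi scalerDr quotpiD.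
Qed.

Lemma quotscaleDl x : {morph quotscale^~ x : a b / a + b}.
Proof.
have [{}x ->] := quotpi_surj x => a b.
by rewrite !quotscale_pi scalerDl quotpiD.
Qed.

HB.instance Definition _ := GRing.Zmodule_isLmodule.Build R quotmod
  quotscaleA quotscale1 quotscaleDr quotscaleDl.

Lemma quotpi_linear : linear quotpi.
Proof. by move=> a x y; rewrite quotpiD -quotscale_pi. Qed.

HB.instance Definition _ :=
  GRing.isLinear.Build R V quotmod _ quotpi quotpi_linear.

Lemma quotpi_eq0 x : quotpi x = 0 <-> x \in sub_pred N.
Proof. by rewrite -(linear0 quotpi) quotpi_eq subr0. Qed.

End QuotientModule.

Section Scale.
Variables (R : pzRingType) (V : lmodType R) (v : V).
Definition scale_by (a : R^o) : V := (a : R) *: v.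
Lemma scale_by_linear : linear scale_by.
Proof. by move=> a x y; rewrite /scale_by scalerDl scalerA. Qed.
HB.instance Definition _ :=
  GRing.isLinear.Build R R^o V _ scale_by scale_by_linear.
End Scale.

(** * Representing objects and jointly epic chains *)

Section Equivalence.
Variables (C : category) (R : pzRingType) (F : functor C (modules R)).
Hypotheses (Ff : faithful F) (Fl : full F) (Fs : essentially_surjective F).

(** The cast exposes a morphism of [modules R] as a linear map that can be applied to elements. *)
Definition applym (X Y : C) (f : hom X Y) : F X -> F Y :=
  (fmap F f : {linear _ -> _}).

Lemma applymM (X Y Z : C) (f : hom Y Z) (g : hom X Y) x :
  applym (cmp f g) x = applym f (applym g x).
Proof. by rewrite /applym fmapM. Qed.

Lemma applym1 (X : C) x : applym (idm X) x = x.
Proof. by rewrite /applym fmap1. Qed.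

Lemma applym_inj (X Y : C) (f g : hom X Y) : applym f =1 applym g -> f = g.
Proof. by move=> fg; apply/Ff/linear_ext. Qed.

(** A linear map out of [R^o] is determined by its value at 1, which is arbitrary. Along an
    isomorphism of [F P] with [R^o], fullness turns this into existence and faithfulness into
    uniqueness. *)
Lemma representing_object : exists (P : C) (e : F P),
  (forall X (x : F X), exists f : hom P X, applym f e = x) /\
  (forall X (f g : hom P X), applym f e = applym g e -> f = g).
Proof.
have [P [f [f' [/= f'f ff']]]] := Fs (R^o : lmodType R).
have f'K x : f' (f x) = x.
  exact: (congr1 (fun h : {linear _ -> _} => h x) f'f).
have fK x : f (f' x) = x.
  exact: (congr1 (fun h : {linear _ -> _} => h x) ff').
exists P, (f' (1 : R^o)); split=> [X x|X g h gh].
  have [g eg] := Fl (scale_by x \o f : {linear F P -> F X}).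
  by exists g; rewrite /applym eg /= fK /scale_by scale1r.
(* Every [x] in [F P] is the multiple [f x *: e] of [e = f' 1]. *)
apply: applym_inj => x; rewrite -(f'K x) -[f x]mulr1.
rewrite -[f x * 1]/(f x *: (1 : R^o)) linearZ.
by move: gh; rewrite /applym !linearZ => ->.
Qed.

(** Each element of [F X] is the image of [e] under some [h], so morphisms that agree after every
    [h] have images under [F] that agree elementwise. *)
Lemma representing_generator (P : C) (e : F P) :
  (forall X (x : F X), exists f : hom P X, applym f e = x) ->
  forall (X Y : C) (f g : hom X Y),
    (forall h : hom P X, cmp f h = cmp g h) -> f = g.
Proof.
move=> eP X Y f g fg; apply: applym_inj => x.
by have [h <-] := eP X x; rewrite -!applymM fg.
Qed.

(** The images of the [F (N n)] form a chain, so their union is a submodule [T]. The projection of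
    [F P] modulo [T] comes from a morphism of [C] that cannot be told from zero on any [N n]; hence
    it is zero and [T] is all of [F P]. *)
Lemma jointly_epic_chain (P : C) (N : nat -> C) (i : forall n, hom (N n) P) :
  (forall m n, (m <= n)%N -> exists j, cmp (i n) j = i m) ->
  (forall (Y : C) (f g : hom P Y),
    (forall n, cmp f (i n) = cmp g (i n)) -> f = g) ->
  forall x : F P, exists n y, applym (i n) y = x.
Proof.
move=> ij epi.
pose T : {pred F P} := fun x => `[< exists n y, applym (i n) y = x >].
have Tcl : submod_closed T.
  split; first by apply/asboolP; exists 0%N, 0; rewrite /applym linear0.
  move=> a x y /asboolP[m [u <-]] /asboolP[n [v <-]]; apply/asboolP.
  have [j jm] := ij _ _ (leq_maxl m n); have [k kn] := ij _ _ (leq_maxr m n).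
  exists (maxn m n), (a *: applym j u + applym k v).
  by rewrite {1}/applym linearP -!/(applym _ _) -!applymM jm kn.
pose N' := Submodule Tcl.
(* The quotient is moved into the essential image of [F]; [g] is the projection and [z] the zero
   map, both pulled back to [C], where the hypothesis [epi] can compare them. *)
have [Y [f fiso]] := Fs (quotmod N' : lmodType R).
have [f' [f'f ff']] := fiso.
have fK x : f (f' x) = x.
  exact: (congr1 (fun h : {linear _ -> _} => h x) ff').
have [g eg] := Fl (f' \o quotpi N' : {linear F P -> F Y}).
have [z ez] := Fl (\0 : {linear F P -> F Y}).
have gz : g = z.
  apply: epi => n; apply: applym_inj => x; rewrite !applymM /applym eg ez /=.
  have -> : quotpi N' (fmap F (i n) x) = 0.
    by apply/quotpi_eq0/asboolP; exists n, x.
  exact: (linear0 (f' : {linear _ -> _})).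
move=> x; apply/asboolP; apply/(@quotpi_eq0 _ _ N'); rewrite -[LHS]fK.
have <- : 0 = f' (quotpi N' x).
  have := congr1 (fun h : {linear F P -> F Y} => h x) eg.
  by rewrite gz ez.
exact: (linear0 (f : {linear _ -> _})).
Qed.
End Equivalence.

(** * Comodules *)

Section ShiftGrading.
Variables (V : zmodType) (g : grading V) (n : int).

Lemma shift_hcompK i j x : hcomp g (i - n) (hcomp g (j - n) x) =
  if i == j then hcomp g (j - n) x else 0.
Proof. by rewrite hcompK (inj_eq (addIr _)). Qed.

Lemma shift_hcomp_fin x : finite_set [set i | hcomp g (i - n) x <> 0].
Proof.
apply: sub_finite_set (finite_image (fun i => i + n) (hcomp_fin g x)) => i hi.
by exists (i - n); rewrite ?subrK.
Qed.

Lemma shift_hcomp_sum x : x = \sum_(i \in [set: int]) hcomp g (i - n) x.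
Proof.
rewrite {1}[x](hcomp_sum g).
apply: (reindex_fsbigT (fun i : int => i - n)).
by exists (fun i => i + n) => i; rewrite ?addrK ?subrK.
Qed.

(** The grading of the [n]-fold suspension, on the same underlying group. *)
Definition shift_grading : grading V :=
  Grading shift_hcompK shift_hcomp_fin shift_hcomp_sum.

End ShiftGrading.

Section GTensor.
Variables (A G : pzRingType) (eL eR : {rmorphism A -> G}) (M : lmodType A).

Lemma gtensDl (x y : G) (m : M) :
  gtens eL eR (x + y) m = gtens eL eR x m + gtens eL eR y m.
Proof. by have [h _ _] := gtens_balanced eL eR M; exact: h. Qed.

Lemma gtensDr (x : G) (m n : M) :
  gtens eL eR x (m + n) = gtens eL eR x m + gtens eL eR x n.
Proof. by have [_ h _] := gtens_balanced eL eR M; exact: h. Qed.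

Lemma gtens_bal (a : A) (x : G) (m : M) :
  gtens eL eR (x * eR a) m = gtens eL eR x (a *: m).
Proof. by have [_ _ h] := gtens_balanced eL eR M; exact: h. Qed.

Lemma gtens0l (m : M) : gtens eL eR 0 m = 0.
Proof. by apply: (addrI (gtens eL eR 0 m)); rewrite -gtensDl !addr0. Qed.

Lemma gtens_scale (a : A) (x : G) (m : M) :
  a *: gtens eL eR x m = gtens eL eR (eL a * x) m.
Proof. exact: gscale_tens. Qed.

End GTensor.

Section GMap.
Variables (A G : pzRingType) (eL eR : {rmorphism A -> G}).

(** Linearity allows [gmap f] itself to be tensored with Gamma and flatness to be applied to it, as
    happens in [sub_coactA]. *)
Lemma gmap_linear (M M' : lmodType A) (f : {linear M -> M'}) :
  linear (gmap f : gtensor eL eR M -> gtensor eL eR M').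
Proof.
move=> a t u; rewrite gmapD; congr (_ + _).
move: t; apply: gtens_ext => [t u'|t u'|x m].
- by rewrite scalerDr gmapD.
- by rewrite gmapD scalerDr.
- by rewrite gtens_scale !gmap_tens gtens_scale.
Qed.

HB.instance Definition _ (M M' : lmodType A) (f : {linear M -> M'}) :=
  GRing.isLinear.Build A (gtensor eL eR M) (gtensor eL eR M') _
    (@gmap A G eL eR M M' f) (gmap_linear f).

End GMap.

Lemma counit_balanced (H : hopf_algebroid) (M : lmodType (hA H)) :
  gbalanced (etaR H) (fun x (m : M) => counit H x *: m).
Proof.
split=> [x y m|x m n|a x m].
- by rewrite rmorphD scalerDl.
- by rewrite scalerDr.
- by rewrite rmorphM counit_etaR scalerA.
Qed.

(** * The unit comodule and its suspensions *)

Section UnitComodule.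
Variables (H : hopf_algebroid) (n : int).
Local Notation eL := (etaL H).
Local Notation eR := (etaR H).
Local Notation A := ((hA H)^o).

Definition unit_grading : grading A := shift_grading (gc_grading (hA H)) n.

Lemma unit_scale : gr_scale_ax unit_grading.
Proof. by move=> i j a m ai mj; rewrite /homog /= -addrA; exact: gc_mul. Qed.

(** The left linear coaction that makes 1 coinvariant. Suspending changes only the grading, so one
    formula serves all [n]. *)
Definition unit_coact (a : A) : gtensor eL eR A := gtens eL eR (eL a) (1 : A).

Lemma unit_coact_linear : linear unit_coact.
Proof.
by move=> a x y; rewrite /unit_coact gtens_scale -rmorphM -gtensDl -rmorphD.
Qed.

HB.instance Definition _ :=
  GRing.isLinear.Build _ _ _ _ unit_coact unit_coact_linear.

Lemma unit_coact_deg k (m : A) : homog unit_grading k m ->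
  gtensor_homog unit_grading k (unit_coact m).
Proof.
move=> mk; exists [:: (eL m, (1 : A))]; split; first by rewrite big_seq1.
(* In the suspension 1 has degree [n], which leaves degree [k - n] for [eL m]. *)
move=> p; rewrite mem_seq1 => /eqP ->; exists (k - n), n; split=> /=.
- by rewrite subrK.
- exact: etaL_deg.
- by rewrite /homog /= subrr; exact: gc_one.
Qed.

Lemma unit_coact_counit (m : A) :
  glift (fun x (a : A) => counit H x *: a) (unit_coact m) = m.
Proof.
rewrite (glift_tens _ _ _ (@counit_balanced H A)) counit_etaL.
exact: mulr1.
Qed.

End UnitComodule.

Lemma gtens_assoc_balanced (H : hopf_algebroid) (M : lmodType (hA H)) (n : M) :
  gbalanced (etaR H) (fun (x1 : hG H) (x2 : lres (etaL H)) =>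
    gtens (etaL H) (etaR H) x1 (gtens (etaL H) (etaR H) (x2 : hG H) n)).
Proof.
split=> [x y m|x y m|a x m]; rewrite ?gtensDl ?gtensDr//.
by rewrite gtens_bal gtens_scale.
Qed.

(** This makes [comul (x) 1] well defined on the tensor product. Balancedness rests on the right
    linearity of [comul]: [comul (x * etaR a)] is [comul x] times [1 (x) etaR a]. *)
Lemma coassoc_l_balanced (H : hopf_algebroid) (M : lmodType (hA H)) :
  gbalanced (etaR H) (fun (x : hG H) (n : M) => 
  glift (fun (x1 : hG H) (x2 : lres (etaL H)) =>
    gtens (etaL H) (etaR H) x1 (gtens (etaL H) (etaR H) (x2 : hG H) n))
    (comul x)).
Proof.
pose L (n : M) (t : gtensor (etaL H) (etaR H) (lres (etaL H))) :=
  glift (fun (x1 : hG H) (x2 : lres (etaL H)) =>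
    gtens (etaL H) (etaR H) x1 (gtens (etaL H) (etaR H) (x2 : hG H) n)) t.
rewrite -[X in gbalanced _ X]/(fun x n => L n (comul x)).
have LD n : {morph L n : t u / t + u} by exact: gliftD (gtens_assoc_balanced n).
have LE n x (y : lres (etaL H)) : L n (gtens (etaL H) (etaR H) x y) =
    gtens (etaL H) (etaR H) x (gtens (etaL H) (etaR H) (y : hG H) n).
  exact: (glift_tens _ _ _ (gtens_assoc_balanced n)).
split=> [x y n|x m n|a x n]; first by rewrite comulD LD.
  move: (comul x); apply: (@gtens_ext _ _ _ _ _ _ (L (m + n))
    (fun t => L m t + L n t)) => [||y z]; first exact: LD.
    by move=> t u /=; rewrite !LD addrACA.
  by rewrite !LE !gtensDr.
rewrite comulM comul_etaR; move: (comul x).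
have mulD (u : gtensor (etaL H) (etaR H) (lres (etaL H))) :
    {morph (fun t => gtensor_mul t u) : t t' / t + t'}.
  exact: (gliftD (gtensor_mul_balanced (@etaL_deg H) (@etaR_deg H) u)).
pose w : gtensor (etaL H) (etaR H) (lres (etaL H)) :=
  gtens (etaL H) (etaR H) 1 (etaR H a : lres (etaL H)).
apply: (@gtens_ext _ _ _ _ _ _ (fun t => L n (gtensor_mul t w)) (L (a *: n)))
  => [t u||y z].
- by rewrite mulD LD.
- exact: LD.
(* The product formula [gtensor_mulE] requires a homogeneous [z]; its sign is trivial here because 1
   has degree 0. *)
elim/(homog_ind (g := gc_grading (hG H))): z => [|z z' Hz Hz'|i z zi].
- have z0 : gtens (etaL H) (etaR H) y (0 : lres (etaL H)) = 0.
    by apply: (addrI (gtens (etaL H) (etaR H) y 0)); rewrite -gtensDr !addr0.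
  have w0 : gtensor_mul 0 w = 0.
    by apply: (addrI (gtensor_mul 0 w)); rewrite -mulD !addr0.
  have L0 m : L m 0 = 0 by apply: (addrI (L m 0)); rewrite -LD !addr0.
  by rewrite [X in gtensor_mul X]z0 w0 [X in _ = L _ X]z0 !L0.
- by rewrite gtensDr mulD !LD Hz Hz'.
rewrite (gtensor_mulE (@etaL_deg H) (@etaR_deg H) _ _ zi (gc_one _)).
rewrite /ksign muln0 expr0 mul1r mulr1 !LE.
by rewrite gtens_bal.
Qed.

(** Both sides are [etaL m (x) (1 (x) 1)]. *)
Lemma unit_coactA (H : hopf_algebroid) (m : (hA H)^o) :
    glift (fun (x : hG H) (n : (hA H)^o) =>
      glift (fun (x1 : hG H) (x2 : lres (etaL H)) =>
        gtens (etaL H) (etaR H) x1 (gtens (etaL H) (etaR H) (x2 : hG H) n))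
        (comul x)) (@unit_coact H m)
    = gmap (@unit_coact H) (@unit_coact H m).
Proof.
transitivity (gtens (etaL H) (etaR H) (etaL H m)
  (unit_coact (1 : (hA H)^o))); last exact/esym/gmap_tens.
rewrite glift_tens; last exact: coassoc_l_balanced.
rewrite comul_etaL glift_tens; last exact: gtens_assoc_balanced.
by rewrite /unit_coact rmorph1.
Qed.

Definition unit_comodule (H : hopf_algebroid) (n : int) : comodule H :=
  @Comodule H (hA H)^o (unit_grading H n) (@unit_scale H n) (@unit_coact H)
    (@unit_coact_deg H n) (@unit_coact_counit H) (@unit_coactA H).

(** * Graded submodules and subcomodules *)

Lemma raddf_fsum (I : choiceType) (U V : zmodType) (f : {additive U -> V})
    (D : set I) (F : I -> U) : finite_set D ->
  f (\sum_(i \in D) F i) = \sum_(i \in D) f (F i).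
Proof. by move=> Df; rewrite !fsbig_finite// raddf_sum. Qed.

Section SubGrading.
Variables (A : gcring) (M : lmodType A) (g : grading M) (N : submodule M).
Hypothesis Nhc : forall i x, x \in sub_pred N -> hcomp g i x \in sub_pred N.

Definition sub_hcomp i (x : submod N) : submod N := Submod (Nhc i (submodP x)).

Lemma sub_hcomp_zmod i : zmod_morphism (sub_hcomp i).
Proof. by move=> x y; apply: val_inj; rewrite /= !raddfB. Qed.

HB.instance Definition _ i :=
  GRing.isZmodMorphism.Build _ _ (sub_hcomp i) (sub_hcomp_zmod i).

Lemma sub_hcompK i j x :
  sub_hcomp i (sub_hcomp j x) = if i == j then sub_hcomp j x else 0.
Proof. by apply: val_inj; rewrite /= hcompK; case: eqP. Qed.

Lemma sub_hcomp_fin x : finite_set [set i | sub_hcomp i x <> 0].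
Proof.
apply: sub_finite_set (hcomp_fin g (val x)) => i /= xi vxi; apply: xi.
exact: val_inj.
Qed.

Lemma sub_hcomp_sum x : x = \sum_(i \in [set: int]) sub_hcomp i x.
Proof.
apply: val_inj; rewrite [LHS](hcomp_sum g).
pose S := [set i | sub_hcomp i x <> 0].
(* An additive map such as [val] is exchanged with a sum over a finite set, so the sum is first cut
   down to the support of [x]. *)
have Sx : \sum_(i \in [set: int]) sub_hcomp i x = \sum_(i \in S) sub_hcomp i x.
  by apply/esym/fsbig_widen => // i [_ /= /contrapT].
rewrite Sx raddf_fsum; last exact: sub_hcomp_fin.
apply/esym/fsbig_widen => // i [_ /= /contrapT].
by move=> /(congr1 val).
Qed.

Definition sub_grading : grading (submod N) :=
  Grading sub_hcompK sub_hcomp_fin sub_hcomp_sum.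

Lemma sub_homog n (x : submod N) : homog sub_grading n x <-> homog g n (val x).
Proof. by split=> [/(congr1 val)//|h]; apply: val_inj. Qed.

End SubGrading.

Section Coassociativity.
Variables (H : hopf_algebroid).
Local Notation eL := (etaL H).
Local Notation eR := (etaR H).

(** The map [comul (x) 1] followed by reassociation; it unfolds to the left side of [coactA]. *)
Definition coassoc_l (P : lmodType (hA H)) :
    gtensor eL eR P -> gtensor eL eR (gtensor eL eR P) :=
  glift (fun (x : hG H) (n : P) =>
      glift (fun (x1 : hG H) (x2 : lres (etaL H)) =>
        gtens (etaL H) (etaR H) x1 (gtens (etaL H) (etaR H) (x2 : hG H) n))
        (comul x)).

Lemma coassoc_l_natural (P Q : lmodType (hA H)) (f : {linear P -> Q}) t :
  gmap (gmap f) (coassoc_l t) = coassoc_l (gmap f t).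
Proof.
have D (K : lmodType (hA H)) : {morph @coassoc_l K : t u / t + u}.
  exact: gliftD (coassoc_l_balanced K).
move: t; apply: gtens_ext => [t u|t u|x n].
- by rewrite D gmapD.
- by rewrite gmapD D.
rewrite gmap_tens [coassoc_l _](glift_tens _ _ _ (coassoc_l_balanced P)).
rewrite [RHS](glift_tens _ _ _ (coassoc_l_balanced Q)).
move: (comul x); apply: gtens_ext => [t u|t u|y z].
- by rewrite (gliftD (gtens_assoc_balanced n)) gmapD.
- by rewrite (gliftD (gtens_assoc_balanced (f n))).
rewrite (glift_tens _ _ _ (gtens_assoc_balanced n)).
rewrite gmap_tens [RHS](glift_tens _ _ _ (gtens_assoc_balanced (f n))).
by congr (gtens _ _ _ _); exact: gmap_tens.
Qed.

End Coassociativity.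

Section Subcomodule.
Variables (H : hopf_algebroid) (Hflat : hopf_flat H).
Variables (M : comodule H) (N : submodule M).
Local Notation g := (cm_grading M).
Local Notation eL := (etaL H).
Local Notation eR := (etaR H).
Hypothesis Nhc : forall i x, x \in sub_pred N -> hcomp g i x \in sub_pred N.
Hypothesis Nco : forall n x, x \in sub_pred N -> homog g n x ->
  exists s : seq (hG H * M), coact M x = \sum_(p <- s) gtens eL eR p.1 p.2 /\
    forall p, p \in s -> p.2 \in sub_pred N /\ exists i j,
      [/\ i + j = n, homog (gc_grading (hG H)) i p.1 & homog g j p.2].

Local Notation incl := (val : {linear submod N -> M}).
Local Notation gincl := (@gmap _ _ eL eR _ _ incl).
Local Notation gN := (sub_grading Nhc).

(** The terms supplied by [Nco] have second factors in [N]. Lifting them one by one keeps their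
    degrees, so the lift of the coaction is homogeneous too. *)
Lemma sub_gtensor_homog n x : homog gN n x ->
  exists2 t, gtensor_homog gN n t & gincl t = coact M (val x).
Proof.
move=> /sub_homog xn; have [s [-> sN]] := Nco (submodP x) xn.
have [s' [es s'P]] : exists s' : seq (hG H * submod N),
    s = [seq (p.1, val p.2) | p <- s'] /\
    forall p, p \in s' -> exists i j,
      [/\ i + j = n, homog (gc_grading (hG H)) i p.1 & homog gN j p.2].
  elim: s sN => [|[y m] s IHs] sN; first by exists [::].
  have [|s' [-> s'P]] := IHs.
    by move=> p ps; apply: sN; rewrite inE ps orbT.
  have [mN [i [j [ij yi mj]]]] := sN _ (mem_head _ _).
  exists ((y, Submod mN) :: s'); split=> // p.
  rewrite inE => /orP[/eqP ->|/s'P//].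
  by exists i, j; split=> //; apply/sub_homog.
exists (\sum_(p <- s') gtens eL eR p.1 p.2); first by exists s'.
rewrite es big_map raddf_sum; apply: eq_bigr => p _.
exact: gmap_tens.
Qed.

Lemma sub_coact_ex (x : submod N) : exists t, gincl t = coact M (val x).
Proof.
elim/(homog_ind (g := gN)): x => [|x y [t et] [u eu]|n x xn].
- by exists 0; rewrite !raddf0.
- by exists (t + u); rewrite !raddfD /= et eu.
- by have [t _ et] := sub_gtensor_homog xn; exists t.
Qed.

(** The lift is picked by choice. It is unique by [gincl_inj], that is by flatness, and the comodule
    axioms follow from those of [M] by this uniqueness. *)
Definition sub_coact (x : submod N) : gtensor eL eR (submod N) :=
  projT1 (cid (sub_coact_ex x)).

Lemma gincl_coact x : gincl (sub_coact x) = coact M (val x).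
Proof. exact: projT2 (cid (sub_coact_ex x)). Qed.

Lemma gincl_inj : injective gincl.
Proof. exact: Hflat val_inj. Qed.

Lemma sub_coact_linear : linear sub_coact.
Proof.
move=> a x y; apply: gincl_inj.
by rewrite gincl_coact !linearP /= !gincl_coact.
Qed.

HB.instance Definition _ :=
  GRing.isLinear.Build _ _ _ _ sub_coact sub_coact_linear.

Lemma sub_scale : gr_scale_ax gN.
Proof.
move=> i j a m ai /sub_homog mj; apply/sub_homog.
exact: (cm_scale ai mj).
Qed.

Lemma sub_coact_deg n m : homog gN n m -> gtensor_homog gN n (sub_coact m).
Proof.
move=> /sub_gtensor_homog[t tn et].
by rewrite (_ : sub_coact m = t)//; apply: gincl_inj; rewrite gincl_coact.
Qed.

Lemma sub_coact_counit m :
  glift (fun x n => counit H x *: n) (sub_coact m) = m.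
Proof.
apply: val_inj; rewrite -[RHS](coact_counit (val m)) -gincl_coact.
move: (sub_coact m); apply: gtens_ext => [t u|t u|x n].
- by rewrite (gliftD (counit_balanced (submod N))) raddfD.
- by rewrite gmapD (gliftD (counit_balanced M)).
by rewrite gmap_tens (glift_tens _ _ _ (counit_balanced (submod N)))
  (glift_tens _ _ _ (counit_balanced M)) linearZ.
Qed.

Lemma sub_coactA m : coassoc_l (sub_coact m) = gmap sub_coact (sub_coact m).
Proof.
(* Flatness is used a second time, now for [gincl], so that the identity can be checked in the
   double tensor product with [M]. *)
apply: (Hflat (f := gincl)) gincl_inj _ _ _.
rewrite coassoc_l_natural gincl_coact.
rewrite -[RHS]gmap_comp.
have -> : gincl \o sub_coact = coact M \o incl.
  by apply/funext => x /=; exact: gincl_coact.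
by rewrite gmap_comp gincl_coact; exact: coactA.
Qed.

Definition subcomodule : comodule H :=
  @Comodule H (submod N) gN sub_scale sub_coact
    sub_coact_deg sub_coact_counit sub_coactA.

Definition sub_incl : comodule_hom subcomodule M.
refine (@ComoduleHom H subcomodule M incl _ _).
Proof.
- by move=> n x /sub_homog.
- by move=> x; rewrite -gincl_coact.
Defined.

Lemma sub_factor (P : comodule H) (f : comodule_hom P M) :
  (forall x, f x \in sub_pred N) ->
  exists h : comodule_hom P subcomodule, forall x, val (h x) = f x.
Proof.
move=> fN; pose h x : submod N := Submod (fN x).
have hl : linear h by move=> a x y; apply: val_inj; rewrite /= linearP.
pose hL := GRing.isLinear.Build _ _ _ _ h hl.
pose hh : {linear P -> submod N} := HB.pack h hL.
have hd : degree_preserving (cm_grading P) gN hh.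
  by move=> n x xn; apply/sub_homog; exact: ch_deg.
have hc m : sub_coact (hh m) = gmap hh (coact P m).
  apply: gincl_inj; rewrite gincl_coact -gmap_comp.
  exact: (ch_coact f m).
by exists (@ComoduleHom H P subcomodule hh hd hc).
Qed.

End Subcomodule.

(** * The filtration by degree of generators *)

Section Generated.
Variables (A : gcring) (M : lmodType A) (g : grading M).
Hypothesis gscale_ax : gr_scale_ax g.

(** Scalars and generators are homogeneous, so each term [a *: m] is homogeneous and inductions can
    follow components. Closure under arbitrary scalars is recovered in [gen_le_closed]. *)
Inductive gen_le (n : int) : M -> Prop :=
| gen_le0 : gen_le n 0
| gen_leD x y : gen_le n x -> gen_le n y -> gen_le n (x + y)
| gen_leZ i j a m : homog (gc_grading A) i a -> homog g j m -> j <= n ->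
    gen_le n (a *: m).

Lemma gen_le_homog n j m : homog g j m -> j <= n -> gen_le n m.
Proof. by rewrite -{2}[m]scale1r; apply: gen_leZ; exact: gc_one. Qed.

Lemma gen_le_closed n : submod_closed (fun x => `[< gen_le n x >]).
Proof.
split; first by apply/asboolP; exact: gen_le0.
move=> a x y /asboolP xn /asboolP yn; apply/asboolP; apply: gen_leD => //.
elim: xn => {x y yn} [|x y _ xn _ yn|i j b m bi mj jn].
- by rewrite scaler0; exact: gen_le0.
- by rewrite scalerDr; exact: gen_leD.
elim/(homog_ind (g := gc_grading A)): a => [|a a' an an'|k a ak].
- by rewrite scale0r; exact: gen_le0.
- by rewrite scalerDl; exact: gen_leD.
by rewrite scalerA; apply: gen_leZ mj jn; exact: gc_mul ak bi.
Qed.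

Definition gen_sub n := Submodule (gen_le_closed n).

Lemma gen_subP n x : reflect (gen_le n x) (x \in sub_pred (gen_sub n)).
Proof. exact: asboolP. Qed.

Lemma gen_sub_mono m n x : m <= n ->
  x \in sub_pred (gen_sub m) -> x \in sub_pred (gen_sub n).
Proof.
move=> mn /gen_subP xm; apply/gen_subP.
elim: xm => {x} [|x y _ xn _ yn|i j b x bi xj jn]; first exact: gen_le0.
  exact: gen_leD.
exact: gen_leZ bi xj (le_trans jn mn).
Qed.

Lemma gen_sub_hcomp n i x :
  x \in sub_pred (gen_sub n) -> hcomp g i x \in sub_pred (gen_sub n).
Proof.
move=> /gen_subP xn; apply/gen_subP.
elim: xn => {x} [|x y _ xn _ yn|k j b x bk xj jn].
- by rewrite raddf0; exact: gen_le0.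
- by rewrite raddfD; exact: gen_leD.
rewrite (hcomp_homog _ (gscale_ax bk xj)).
by case: eqP => _; [exact: gen_leZ bk xj jn|exact: gen_le0].
Qed.

End Generated.

Section GeneratedComodule.
Variables (H : hopf_algebroid) (Hconn : connective (gc_grading (hG H))).
Variable M : comodule H.
Local Notation g := (cm_grading M).
Local Notation eL := (etaL H).
Local Notation eR := (etaR H).
Local Notation N n := (gen_sub g n).

(* By connectivity of Gamma, the second factors of the coaction on an element
   of degree j have degree at most j. *)
Lemma gen_sub_coact n k x : x \in sub_pred (N n) -> homog g k x ->
  exists s : seq (hG H * M), coact M x = \sum_(p <- s) gtens eL eR p.1 p.2 /\
    forall p, p \in s -> p.2 \in sub_pred (N n) /\ exists i j,
      [/\ i + j = k, homog (gc_grading (hG H)) i p.1 & homog g j p.2].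
Proof.
(* The summands of [x] need not have degree [k]; writing [x] as its own component of degree [k]
   gives a claim that passes to sums. *)
move=> /gen_subP xn xk; rewrite -{}xk.
elim: xn => {x} [|x y _ [s [es sP]] _ [t [et tP]]|k' j b x bk xj jn].
- by exists [::]; rewrite !raddf0 big_nil.
- exists (s ++ t); rewrite !raddfD /= es et big_cat; split=> // p.
  by rewrite mem_cat => /orP[/sP|/tP].
rewrite (hcomp_homog _ (cm_scale bk xj)); case: eqP => [->|_]; last first.
  by exists [::]; rewrite raddf0 big_nil.
have [s [es sP]] := coact_deg xj.
(* Terms with zero first factor are dropped: zero is homogeneous of every degree, so connectivity
   would not bound the degree of the second factor. *)
exists [seq (eL b * p.1, p.2) | p <- s & p.1 != 0]; split.
  rewrite linearZ /= es scaler_sumr big_map big_filter [RHS]big_mkcond.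
  apply: eq_bigr => p _; rewrite gtens_scale.
  by case: eqP => //= ->; rewrite mulr0 gtens0l.
move=> _ /mapP[p + ->]; rewrite mem_filter.
move=> /andP[/eqP p0 /sP[i [l [il pi pl]]]].
split=> /=; last first.
  exists (k' + i), l; split=> //; first by rewrite -addrA il.
  exact: gc_mul (etaL_deg bk) pi.
apply/gen_subP/(gen_le_homog pl)/(le_trans _ jn); rewrite -il lerDr leNgt.
by apply/negP => i0; apply: p0; exact: Hconn i0 pi.
Qed.

End GeneratedComodule.

Section ConnectiveHopfAlgebroid.
Variables (H : hopf_algebroid) (Hflat : hopf_flat H).
Hypotheses (Aconn : connective (gc_grading (hA H)))
  (Gconn : connective (gc_grading (hG H))).

Section Filtration.
Variables (P : conn_comodule H).
Local Notation g := (cm_grading P).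

Definition filtration (n : nat) : comodule H :=
  subcomodule Hflat (@gen_sub_hcomp _ _ g (@cm_scale _ P) n)
    (@gen_sub_coact _ Gconn P n).

Lemma filtration_conn n : connective (cm_grading (filtration n)).
Proof.
by move=> k x k0 /sub_homog xk; apply: val_inj; exact: cc_conn k0 xk.
Qed.

Definition conn_filtration n : conn_comodule H :=
  ConnComodule (@filtration_conn n).

Definition filtration_incl n : comodule_hom (conn_filtration n) P :=
  sub_incl _ _ _.

(** These are the transition maps required by [jointly_epic_chain]. *)
Lemma filtration_step m n : (m <= n)%N ->
  exists j : comodule_hom (conn_filtration m) (conn_filtration n),
    comodule_cmp (filtration_incl n) j = filtration_incl m.
Proof.
move=> mn.
have [x|j jE] := @sub_factor _ Hflat P _
  (@gen_sub_hcomp _ _ g (@cm_scale _ P) n) (@gen_sub_coact _ Gconn P n) _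
  (filtration_incl m).
  by apply: (@gen_sub_mono _ _ g m) (submodP x); rewrite lez_nat.
by exists j; apply: comodule_hom_ext => x; exact: jE.
Qed.

Lemma filtration_jointly_epic (Q : comodule H) (u v : comodule_hom P Q) :
  (forall n, comodule_cmp u (filtration_incl n) =
             comodule_cmp v (filtration_incl n)) -> u = v.
Proof.
move=> uv; apply: comodule_hom_ext.
apply: (homog_ind (g := g)) => [|x y ux uy|k x xk]; first by rewrite !raddf0.
  by rewrite !raddfD /= ux uy.
(* The stages are indexed by natural numbers, and the absolute value of [k] is an upper bound for
   [k] of either sign. *)
have xN : x \in sub_pred (gen_sub g `|k|%N).
  by apply/gen_subP/(gen_le_homog xk); rewrite abszE ler_norm.
exact: (congr1 (fun h : comodule_hom (filtration `|k|%N) Q => h (Submod xN))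
  (uv `|k|%N)).
Qed.
End Filtration.

(** * Connective suspensions and zero morphisms *)

Definition unit_conn_comodule (n : nat) : conn_comodule H.
refine (@ConnComodule H (unit_comodule H n) _).
Proof.
move=> k x k0; apply: (Aconn (n := k - n%:Z)).
by rewrite subr_lt0; exact: lt_le_trans k0 _.
Defined.

Lemma comodule_zero_coact (M N : comodule H) m :
  coact N ((\0 : {linear M -> N}) m) = gmap (\0 : {linear M -> N}) (coact M m).
Proof.
rewrite /= raddf0; move: (coact M m).
apply: (gtens_ext (g := fun=> 0)) => [t u|t u|x n].
- by rewrite addr0.
- exact: gmapD.
rewrite gmap_tens /=; apply: (addrI (gtens (etaL H) (etaR H) x 0)).
by rewrite -gtensDr !addr0.
Qed.

Definition comodule_zero (M N : comodule H) : comodule_hom M N.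
refine (@ComoduleHom H M N (\0 : {linear M -> N}) _ (@comodule_zero_coact M N)).
Proof. by move=> n x _; rewrite /homog raddf0. Defined.

(** The generators of [P] have degree at most [n] and are sent to degrees in which [Q] vanishes. *)
Lemma hom_from_generated (P Q : comodule H) (n : int) (f : comodule_hom P Q) :
  (forall x, gen_le (cm_grading P) n x) ->
  (forall k x, k <= n -> homog (cm_grading Q) k x -> x = 0) ->
  f = comodule_zero P Q.
Proof.
move=> Pn Q0; apply: comodule_hom_ext => x /=.
elim: (Pn x) => {x} [|x y _ fx _ fy|i j a m ai mj jn].
- exact: raddf0.
- by rewrite raddfD /= fx fy addr0.
- by rewrite linearZ /= (Q0 j (f m)) ?scaler0//; exact: ch_deg.
Qed.

End ConnectiveHopfAlgebroid.

Theorem proposition3p9 (H : hopf_algebroid) :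
  hopf_connective H -> hopf_finite_type H -> hopf_flat H ->
  1 <> 0 :> hA H ->
  forall R : pzRingType, ~ equivalent (connective_comodules H) (modules R).
Proof.
move=> [Aconn Gconn] _ Hflat A1 R /equivalence_properties[F [Ff Fl Fs]].
have [P [e [eP eI]]] := representing_object Ff Fl Fs.
have [n [y ey]] := @jointly_epic_chain _ _ F Ff Fl Fs P
  (conn_filtration Hflat Gconn P) (filtration_incl Hflat Gconn P)
  (@filtration_step _ Hflat Gconn P)
  (@filtration_jointly_epic _ Hflat Gconn P) e.
have [f ef] := eP _ y.
pose i : @hom (connective_comodules H) _ P := filtration_incl Hflat Gconn P n.
(* Both morphisms send [e] to itself, so they agree by representability; thus [f] is a section of
   the inclusion [i]. *)
have idE : cmp i f = idm P by apply: eI; rewrite applymM ef ey applym1.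
have Pn x : gen_le (cm_grading P) n x.
  rewrite -[x]/((idm P : comodule_hom _ _) x) -idE; apply/gen_subP.
  exact: submodP.
(* The shift [n.+1] is the least for which connectivity of A makes all degrees up to [n] vanish. *)
pose U := unit_conn_comodule Aconn n.+1.
have /(congr1 (fun h : comodule_hom U U => h (1 : (hA H)^o))) :
    @idm (connective_comodules H) U = comodule_zero U U.
  (* The identity and the zero endomorphism of [U] agree on all morphisms from the generator [P],
     since every morphism from [P] to [U] is zero. Evaluated at 1, their equality contradicts
     [A1]. *)
  apply: (representing_generator Ff eP) => h.
  have h0 (u : @hom (connective_comodules H) U U) :
    cmp u h = comodule_zero P U.
    apply: (@hom_from_generated H P U _ (cmp u h) Pn) => k x kn xk.
    apply: (Aconn (k - n.+1%:Z) x) => //.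
    by move: kn; lia.
  by rewrite !h0.
exact: A1.
Qed.
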